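(* Let $A$ be an $N\times N$ Hermitian matrix, let $k\ge 1$, let $\lambda\in\Lambda_k(A)$, and suppose that $\lambda$ is an eigenvalue of $A$. Let $P_+$, $P_0$, $P_-$ be the orthogonal projections onto the spans of the eigenvectors of $A-\lambda I$ for, respectively, its positive eigenvalues, the eigenvalue zero, and its negative eigenvalues. Let $f:\mathbb{R}\to\mathbb{R}$ be given by $f(x)=|x|^{-1/2}$ if $x\ne 0$ and $f(0)=1$. Consider any non-negative integers $k_1,k_2$ with $k_1+k_2=k$, $k_1\le\dim P_0\mathbb{C}^N$ and $k_2\le\min\{\dim P_-\mathbb{C}^N,\dim P_+\mathbb{C}^N\}$; any $k_1$-dimensional subspace $\mathcal{V}_0$ of $P_0\mathbb{C}^N$; any $k_2$-dimensional subspace $\mathcal{V}_+$ of $P_+\mathbb{C}^N$; any linear operator $X:\mathcal{V}_+\to(\mathcal{V}_0)^\perp\cap P_0\mathbb{C}^N$; and any linear isometry $U:\mathcal{V}_+\to P_-\mathbb{C}^N$. Define $$\mathcal{V}=\mathcal{V}_0+\{v+Xv+Uv: v\in\mathcal{V}_+\},\qquad \mathcal{W}=f(A-\lambda I)\,\mathcal{V}.$$ Then $\mathcal{W}$ is a $k$-dimensional subspace of $\mathbb{C}^N$ and the orthogonal projection $P_{\mathcal{W}}$ onto $\mathcal{W}$ satisfies $P_{\mathcal{W}}AP_{\mathcal{W}}=\lambda P_{\mathcal{W}}$. Moreover, every rank-$k$ orthogonal projection $P$ with $PAP=\lambda P$ is of the form $P_{\mathcal{W}}$ for some $\mathcal{W}$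 obtained in this way.
   Context: For an $N\times N$ complex matrix $T$ and an integer $k\ge 1$, the rank-$k$ numerical range of $T$ is $$\Lambda_k(T)=\{\lambda\in\mathbb{C}: PTP=\lambda P \text{ for some rank-}k\text{ projection } P \text{ on } \mathbb{C}^N\},$$ where ''projection'' means orthogonal projection. For Hermitian $A$, $\Lambda_k(A)\subseteq\mathbb{R}$. The operator $f(A-\lambda I)$ is defined by the functional calculus for Hermitian matrices. *)

(* Defs.v *)
From HB Require Import structures.
From mathcomp Require Import all_boot all_order all_algebra.
From mathcomp Require Import sesquilinear spectral complex.
From mathcomp Require Import reals exp.

Set Implicit Arguments.
Unset Strict Implicit.
Unset Printing Implicit Defensive.

Import Order.TTheory GRing.Theory Num.Theory.
Local Open Scope ring_scope.

(* C^N is 'cV[C]_N with matrices acting by left multiplication.  The purely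
   linear-algebraic notions are set up over any numClosedFieldType C; the
   complex numbers proper are R[i] for R : realType. *)

(* The standard inner product \sum_i u_i (v_i)^*, linear in its first
   argument. *)
Definition cdot (C : numClosedFieldType) (N : nat) : 'cV[C]_N -> 'cV[C]_N -> C :=
  form_of_matrix Num.conj (1%:M : 'M[C]_1).

HB.instance Definition _ (C : numClosedFieldType) (N : nat) :=
  Bilinear.copy (@cdot C N)
    (form_of_matrix Num.conj (mx_of_hermitian (hermitian1mx 1))).
HB.instance Definition _ (C : numClosedFieldType) (N : nat) :=
  Hermitian.copy (@cdot C N)
    (form_of_matrix Num.conj (mx_of_hermitian (hermitian1mx 1))).

Definition cnorm (C : numClosedFieldType) (N : nat) (v : 'cV[C]_N) : C :=
  sqrtC (cdot v v).

Definition ocompl (C : numClosedFieldType) (N : nat) (W : {vspace 'cV[C]_N}) :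
  {vspace 'cV[C]_N} := orthov (@cdot C N) W.

Definition colop (C : numClosedFieldType) (N : nat) (B : 'M[C]_N) : 'End('cV[C]_N) :=
  linfun (mulmx B : 'cV[C]_N -> 'cV[C]_N).

Definition mxrange (C : numClosedFieldType) (N : nat) (B : 'M[C]_N) :
  {vspace 'cV[C]_N} := limg (colop B).

Definition is_orthoproj (C : numClosedFieldType) (N : nat) (P : 'M[C]_N) : Prop :=
  P \is hermsymmx /\ P *m P = P.

(* The matrix of the projection onto W along its orthogonal complement. *)
Definition orthoproj (C : numClosedFieldType) (N : nat) (W : {vspace 'cV[C]_N}) :
  'M[C]_N :=
  \matrix_(i, j) (daddv_pi W (ocompl W) (delta_mx j 0 : 'cV[C]_N)) i 0.

Definition rank_numrange (C : numClosedFieldType) (N k : nat) (T : 'M[C]_N)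
    (lambda : C) : Prop :=
  exists P : 'M[C]_N,
    [/\ is_orthoproj P, \rank P = k & P *m T *m P = lambda *: P].

(* The span of the eigenvectors of a Hermitian B whose eigenvalue satisfies p;
   spectral_diag B lists the eigenvalues of B with multiplicity, and repeated
   summands are harmless. *)
Definition eigspan (C : numClosedFieldType) (N : nat) (B : 'M[C]_N) (p : pred C) :
  {vspace 'cV[C]_N} :=
  (\sum_(j < N | p (spectral_diag B 0%R j))
     passmx.leigenspace (colop B) (spectral_diag B 0%R j))%VS.

Definition proj_pos (C : numClosedFieldType) (N : nat) (B : 'M[C]_N) : 'M[C]_N :=
  orthoproj (eigspan B (fun mu => 0 < mu)).
Definition proj_zero (C : numClosedFieldType) (N : nat) (B : 'M[C]_N) : 'M[C]_N :=
  orthoproj (eigspan B (fun mu => mu == 0)).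
Definition proj_neg (C : numClosedFieldType) (N : nat) (B : 'M[C]_N) : 'M[C]_N :=
  orthoproj (eigspan B (fun mu => mu < 0)).

Definition incl (C : numClosedFieldType) (N : nat) (V : {vspace 'cV[C]_N}) :
  'Hom(subvs_of V, 'cV[C]_N) := linfun (vsval : subvs_of V -> 'cV[C]_N).

(* The subspace {v + X v + U v : v \in Vp}. *)
Definition graph_space (C : numClosedFieldType) (N : nat)
    (Vp S T : {vspace 'cV[C]_N})
    (X : 'Hom(subvs_of Vp, subvs_of S)) (U : 'Hom(subvs_of Vp, subvs_of T)) :
  {vspace 'cV[C]_N} :=
  limg (incl Vp + (incl S \o X) + (incl T \o U))%VF.

(* Functional calculus for Hermitian B = S^-1 *m diag_mx d *m S: the entries of
   d are then the (real) eigenvalues of B, and f(B) = S^-1 *m f(d) *m S. *)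
Definition mxfun (R : realType) (N : nat) (f : R -> R) (B : 'M[R[i]]_N) :
  'M[R[i]]_N :=
  invmx (spectralmx B)
    *m diag_mx (map_mx (fun z : R[i] => real_complex R (f (complex.Re z)))
                       (spectral_diag B))
    *m spectralmx B.

Definition inv_sqrt_abs (R : realType) (x : R) : R :=
  if x == 0 then 1 else `|x| `^ (- 2^-1).

(* The subspaces W = f(A - lambda I) V arising from all admissible choices of
   k1, k2, V0, Vp, X, U. *)
Inductive constructed (R : realType) (N : nat) (A : 'M[R[i]]_N)
    (lambda : R[i]) (k : nat) : {vspace 'cV[R[i]]_N} -> Prop :=
| Constructed (B := A - lambda%:M) (k1 k2 : nat)
    (V0 Vp : {vspace 'cV[R[i]]_N})
    (X : 'Hom(subvs_of Vp, subvs_of (ocompl V0 :&: mxrange (proj_zero B))%VS))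
    (U : 'Hom(subvs_of Vp, subvs_of (mxrange (proj_neg B)))) :
    (k1 + k2 = k)%N ->
    (k1 <= \dim (mxrange (proj_zero B)))%N ->
    (k2 <= minn (\dim (mxrange (proj_neg B))) (\dim (mxrange (proj_pos B))))%N ->
    (V0 <= mxrange (proj_zero B))%VS -> \dim V0 = k1 ->
    (Vp <= mxrange (proj_pos B))%VS -> \dim Vp = k2 ->
    (forall v : subvs_of Vp, cnorm (vsval (U v)) = cnorm (vsval v)) ->
    constructed A lambda k
      (colop (mxfun (@inv_sqrt_abs R) B) @: (V0 + graph_space X U))%VS.

(* Main.v *)
(* With B = A - lambda I, the equation P A P = lambda P says that the form <B u, v>
   vanishes on the range of P.  Since f(B) B f(B) = P_+ - P_-, the invertible
   operator f(B) carries this form to <P_+ u, v> - <P_- u, v>.  A subspace V is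
   totally isotropic for the latter exactly when P_+ v |-> P_- v is a
   well-defined isometry on V, i.e. when V is the sum of its intersection V_0
   with the kernel of B and of a graph over P_+ V whose negative component is an
   isometry. *)

Require Import Defs.
From mathcomp Require Import all_boot all_order all_algebra.
From mathcomp Require Import sesquilinear spectral complex.
From mathcomp Require Import reals exp.

Set Implicit Arguments.
Unset Strict Implicit.
Unset Printing Implicit Defensive.

Import Order.TTheory GRing.Theory Num.Theory.
Local Open Scope ring_scope.
Local Open Scope sesquilinear_scope.

(** * Orthogonal complements, orthogonal projections and polarization in C^N *)

Section InnerProduct.
Variables (C : numClosedFieldType) (N : nat).
Implicit Types (A B P : 'M[C]_N) (u v w : 'cV[C]_N) (W : {vspace 'cV[C]_N}).

Lemma hermsymmxE A : (A \is hermsymmx) = (A == A^t*).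
Proof. by rewrite is_hermitianmxE expr0 scale1r. Qed.

Lemma colopE A v : colop A v = A *m v.
Proof. by rewrite lfunE. Qed.

Lemma cdotE u v : cdot u v = \sum_i u i 0 * (v i 0)^*.
Proof.
rewrite /cdot /form_of_matrix mulmx1; apply: eq_bigr => i _.
by rewrite !mxE big_ord1 !mxE.
Qed.

Lemma cdot_adjoint A u v : cdot (A *m u) v = cdot u (A^t* *m v).
Proof.
rewrite /cdot /form_of_matrix !mulmx1 -mulmxA mxtrace_mulC -mulmxA.
by rewrite trmx_mul map_mxM trmxCK.
Qed.

Lemma cdot_hermmx P u v : P \is hermsymmx -> cdot (P *m u) v = cdot u (P *m v).
Proof. by rewrite hermsymmxE => /eqP hP; rewrite cdot_adjoint -hP. Qed.

Lemma cdotC u v : cdot u v = (cdot v u)^*.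
Proof. by rewrite (hermC (@cdot C N)) expr0 mul1r. Qed.

Lemma cdot_eq0 u : cdot u u = 0 -> u = 0.
Proof.
rewrite cdotE => /eqP; rewrite psumr_eq0 => [|i _]; last exact: mul_conjC_ge0.
move=> /allP u0; apply/matrixP => i j; rewrite (ord1 j) mxE; apply/eqP.
by have := u0 i (mem_index_enum _); rewrite mul_conjC_eq0.
Qed.

Lemma cnorm_eq u v : cnorm u = cnorm v -> cdot u u = cdot v v.
Proof. by move=> /(congr1 (fun x => x ^+ 2)); rewrite !sqrtCK. Qed.

Lemma capv_ocompl W : (W :&: ocompl W = 0)%VS.
Proof.
apply/eqP; rewrite -subv0; apply/subvP => u; rewrite memv_cap memv0.
by case/andP=> uW /mem_orthovP /(_ _ uW) /cdot_eq0 ->.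
Qed.

(** A dimension count: pairing u with a basis of [W] is a linear map [F] into a space of dimension
    [\dim W], and its kernel lies in [ocompl W]. Rank-nullity then gives [ocompl W] dimension at
    least N - [\dim W], and the sum is direct. *)
Lemma addv_ocompl W : (W + ocompl W = fullv)%VS.
Proof.
apply/eqP; rewrite eqEdim subvf /= dimv_disjoint_sum ?capv_ocompl //.
pose M : 'M[C]_(\dim W, N) := \matrix_(i, j) ((vbasis W)`_i j 0)^*.
pose F : 'Hom('cV[C]_N, 'cV[C]_(\dim W)) := linfun (mulmx M).
have kerF : (lker F <= ocompl W)%VS.
  apply/subvP => u; rewrite memv_ker lfunE /= => /eqP/colP Mu0.
  apply/mem_orthovP => v /coord_vbasis ->.
  rewrite linear_sumr big1 // => i _; rewrite linearZr_LR /=.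
  suff -> : cdot u (vbasis W)`_i = 0 by rewrite mulr0.
  rewrite cdotE; move: (Mu0 i); rewrite !mxE => Mui; rewrite -[RHS]Mui.
  by apply: eq_bigr => j _; rewrite mxE mulrC.
rewrite -(limg_ker_dim F fullv) capfv addnC leq_add ?dimvS //.
by have := dimvS (subvf (limg F)); rewrite dimvf /dim /= muln1.
Qed.

Lemma daddv_pi_ocompl W v : v - daddv_pi W (ocompl W) v \in ocompl W.
Proof.
have /(daddv_pi_add (capv_ocompl W)) {1}<- : v \in (W + ocompl W)%VS.
  by rewrite addv_ocompl memvf.
by rewrite addrC addKr memv_pi.
Qed.

Lemma orthoprojE W v : orthoproj W *m v = daddv_pi W (ocompl W) v.
Proof.
have {2}-> : v = \sum_j v j 0 *: delta_mx j 0.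
  by rewrite [LHS]matrix_sum_delta; apply: eq_bigr => j _; rewrite big_ord1.
rewrite linear_sum; apply/colP => i; rewrite summxE mxE.
by apply: eq_bigr => j _; rewrite linearZ !mxE mulrC.
Qed.

Lemma memv_orthoproj W v : orthoproj W *m v \in W.
Proof. by rewrite orthoprojE memv_pi. Qed.

Lemma orthoproj_id W v : v \in W -> orthoproj W *m v = v.
Proof. by move=> vW; rewrite orthoprojE daddv_pi_id ?capv_ocompl. Qed.

Lemma cdot_orthoproj W u v :
  u \in W -> cdot u (orthoproj W *m v) = cdot u v.
Proof.
move=> uW; apply/esym/eqP; rewrite -subr_eq0 -linearBr orthoprojE /=.
by rewrite cdotC (mem_orthovP (daddv_pi_ocompl W v)) // conjC0.
Qed.

Lemma mx_eqP m n (A B : 'M[C]_(m, n)) :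
  (forall u : 'cV_n, A *m u = B *m u) -> A = B.
Proof.
move=> eqAB; apply/matrixP => i j.
by have /colP/(_ i) := eqAB (delta_mx j 0); rewrite -!colE !mxE.
Qed.

Lemma cdot_eq u v : (forall w, cdot u w = cdot v w) -> u = v.
Proof.
move=> eq_uv; apply/eqP; rewrite -subr_eq0; apply/eqP/cdot_eq0.
by rewrite linearBl /= eq_uv subrr.
Qed.

Lemma adjoint_eq A B : (forall u v, cdot (A *m u) v = cdot u (B *m v)) -> A^t* = B.
Proof.
move=> adjAB; apply: mx_eqP => v; apply: cdot_eq => u.
by rewrite cdotC -cdot_adjoint adjAB -cdotC.
Qed.

Lemma is_orthoproj_orthoproj W : is_orthoproj (orthoproj W).
Proof.
split; last first.
  by apply: mx_eqP => u; rewrite -mulmxA orthoproj_id // memv_orthoproj.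
rewrite hermsymmxE; apply/eqP/esym/adjoint_eq => u v.
rewrite -(cdot_orthoproj v (memv_orthoproj W u)) cdotC.
by rewrite (cdot_orthoproj u (memv_orthoproj W v)) -cdotC.
Qed.

Lemma memv_mxrange P v : P *m P = P -> (v \in mxrange P) = (P *m v == v).
Proof.
move=> PP; apply/memv_imgP/eqP => [[u _ ->]|Pv].
  by rewrite colopE mulmxA PP.
by exists v; rewrite ?memvf // colopE Pv.
Qed.

Lemma mxrange_orthoproj W : mxrange (orthoproj W) = W.
Proof.
have [_ PP] := is_orthoproj_orthoproj W.
apply/vspaceP => v; rewrite memv_mxrange //; apply/eqP/idP => [<-|].
  exact: memv_orthoproj.
exact: orthoproj_id.
Qed.

(** With Q the projection onto the range of P, <Pu, v> = <Pu, Qv> because Pu lies in that range, and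
    <Pu, Qv> = <u, PQv> = <u, Qv> because P fixes Qv. This lets projections and subspaces be
    exchanged freely. *)
Lemma orthoproj_mxrange P : is_orthoproj P -> orthoproj (mxrange P) = P.
Proof.
case=> hP PP; have [hQ QQ] := is_orthoproj_orthoproj (mxrange P).
apply: mx_eqP => u; apply: cdot_eq => v; rewrite cdot_hermmx //.
have Pv w : P *m w \in mxrange P by rewrite memv_mxrange // mulmxA PP.
rewrite -(cdot_orthoproj v (Pv u)) cdot_hermmx //.
by have := memv_orthoproj (mxrange P) v; rewrite memv_mxrange // => /eqP ->.
Qed.

Lemma dim_limg_leq (aT rT : vectType C) (f : 'Hom(aT, rT)) (V : {vspace aT}) :
  (\dim (f @: V) <= \dim V)%N.
Proof. by rewrite -(limg_ker_dim f V) leq_addl. Qed.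

(** Each inequality comes from a factorization of [A]: through [col_base A] and [row_base A] for the
    upper bound on the dimension, and through coordinates in a basis of the range for the upper
    bound on the rank. *)
Lemma dim_mxrange A : \dim (mxrange A) = \rank A.
Proof.
apply/eqP; rewrite eqn_leq; apply/andP; split.
  have -> : mxrange A = (linfun (mulmx (col_base A)) @:
      (linfun (mulmx (row_base A) : 'cV[C]_N -> 'cV[C]_(\rank A)) @: fullv))%VS.
    rewrite -limg_comp; congr (_ @: _)%VS; apply/lfunP => u.
    by rewrite comp_lfunE !lfunE /= mulmxA mulmx_base.
  apply: leq_trans (dim_limg_leq _ _) _.
  by apply: leq_trans (dimvS (subvf _)) _; rewrite dimvf /dim /= muln1.
pose M : 'M[C]_(N, \dim (mxrange A)) := \matrix_(i, j) (vbasis (mxrange A))`_j i 0.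
pose D : 'M[C]_(\dim (mxrange A), N) :=
  \matrix_(i, j) coord (vbasis (mxrange A)) i (col j A).
have defA : A = M *m D.
  apply/matrixP => i j; rewrite mxE.
  have Aj : col j A \in mxrange A by rewrite colE -colopE memv_img ?memvf.
  transitivity (col j A i 0); first by rewrite mxE.
  rewrite {1}(coord_vbasis Aj) summxE.
  by apply: eq_bigr => l _; rewrite !mxE mulrC.
by rewrite {1}defA; apply: leq_trans (mxrankM_maxl M D) (rank_leq_col M).
Qed.

(** The difference D of the two forms is sesquilinear and zero on the diagonal. Expanding at x + y
    gives D x y = - D y x, expanding at x + iy gives D y x = D x y, so 2 D x y = 0. *)
Lemma polarization (vT : vectType C) (f g : 'Hom(vT, 'cV[C]_N)) :
    (forall x, cdot (f x) (f x) = cdot (g x) (g x)) ->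
  forall x y, cdot (f x) (f y) = cdot (g x) (g y).
Proof.
move=> fg x y; pose D x y := cdot (f x) (f y) - cdot (g x) (g y).
have Dxx z : D z z = 0 by rewrite /D fg subrr.
have Dl z : {morph D^~ z : a b / a + b}.
  by move=> a b; rewrite /D !linearD !linearDl /= addrACA -opprD.
have Dr z : {morph D z : a b / a + b}.
  by move=> a b; rewrite /D !linearD !linearDr /= addrACA -opprD.
have Dil : D ('i *: y) x = 'i * D y x.
  by rewrite /D !linearZ !linearZl_LR mulrBr.
have Dir : D x ('i *: y) = - 'i * D x y.
  by rewrite /D !linearZ !linearZr_LR /= conjCi mulrBr.
have := Dxx (x + y); rewrite Dl !Dr !Dxx add0r addr0 => Dxy.
have := Dxx (x + 'i *: y); rewrite Dl !Dr !Dxx add0r addr0 Dil Dir mulNr.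
move=> /eqP; rewrite addrC subr_eq0 => /eqP/(mulfI (neq0Ci C)) Dyx.
move/eqP: Dxy; rewrite Dyx -mulr2n mulrn_eq0 /= => /eqP Dxy.
by apply/eqP; rewrite -subr_eq0 -/(D x y) Dxy.
Qed.

Lemma inclE W (x : subvs_of W) : incl W x = vsval x.
Proof. by rewrite lfunE. Qed.

Lemma orthoproj_mul0C A B : is_orthoproj A -> is_orthoproj B ->
  A *m B = 0 -> B *m A = 0.
Proof.
case; rewrite hermsymmxE => /eqP hA _ []; rewrite hermsymmxE => /eqP hB _ AB0.
by rewrite hA hB -map_mxM -trmx_mul AB0 trmx0 map_mx0.
Qed.

(** An isometry has trivial kernel. This supplies the bound of k2 by the dimension of the negative
    space when a given projection is decomposed. *)
Lemma dim_isometry (Vp W : {vspace 'cV[C]_N}) (U : 'Hom(subvs_of Vp, subvs_of W)) :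
    (forall x : subvs_of Vp, cnorm (vsval (U x)) = cnorm (vsval x)) ->
  (\dim Vp <= \dim W)%N.
Proof.
move=> isoU; have <- : \dim (limg U) = \dim Vp.
  rewrite limg_dim_eq ?dimvf // capfv; apply/eqP; rewrite -subv0.
  apply/subvP => x; rewrite memv_ker memv0 => /eqP Ux0.
  have /cnorm_eq := isoU x; rewrite Ux0 linear0 linear0l => /esym/cdot_eq0 x0.
  by apply/eqP/val_inj; rewrite /= x0.
by apply: leq_trans (dimvS (subvf _)) _; rewrite dimvf.
Qed.

(** * Totally isotropic subspaces of the form <(P_+ - P_-) u, v> *)

Section Signature.
Variables Pp P0 Pm : 'M[C]_N.
Hypotheses (hPp : is_orthoproj Pp) (hP0 : is_orthoproj P0) (hPm : is_orthoproj Pm).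
Hypotheses (Pp0 : Pp *m P0 = 0) (Ppm : Pp *m Pm = 0) (Pm0 : Pm *m P0 = 0).
Hypothesis (P1 : Pp + P0 + Pm = 1%:M).

Let Pmp : Pm *m Pp = 0. Proof. exact: orthoproj_mul0C Ppm. Qed.

Definition isotropic W :=
  {in W &, forall u v, cdot ((Pp - Pm) *m u) v = 0}.

Section Graph.
Variables V0 Vp S : {vspace 'cV[C]_N}.
Variables (X : 'Hom(subvs_of Vp, subvs_of S))
          (U : 'Hom(subvs_of Vp, subvs_of (mxrange Pm))).
Hypotheses (sV0 : (V0 <= mxrange P0)%VS) (sVp : (Vp <= mxrange Pp)%VS)
           (sS : (S <= mxrange P0)%VS).
Hypothesis isoU : forall v : subvs_of Vp, cnorm (vsval (U v)) = cnorm (vsval v).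

Let graph_map := (incl Vp + (incl S \o X) + (incl (mxrange Pm) \o U))%VF.

Lemma graph_mapE x : graph_map x = vsval x + vsval (X x) + vsval (U x).
Proof. by rewrite /graph_map !add_lfunE !comp_lfunE !inclE. Qed.

Let fixp x : Pp *m (vsval x : 'cV[C]_N) = vsval (x : subvs_of Vp).
Proof. by apply/eqP; rewrite -memv_mxrange ?(subvP sVp) ?subvsP; case: hPp. Qed.

Let fix0 v : v \in mxrange P0 -> P0 *m v = v.
Proof. by move=> hv; apply/eqP; rewrite -memv_mxrange //; case: hP0. Qed.

Let fixm v : v \in mxrange Pm -> Pm *m v = v.
Proof. by move=> hv; apply/eqP; rewrite -memv_mxrange //; case: hPm. Qed.

Lemma Pp_graph x : Pp *m graph_map x = vsval x.
Proof.
rewrite graph_mapE !mulmxDr fixp -(fix0 (subvP sS _ (subvsP (X x)))).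
by rewrite -(fixm (subvsP (U x))) !mulmxA Pp0 Ppm !mul0mx !addr0.
Qed.

Lemma Pm_graph x : Pm *m graph_map x = vsval (U x).
Proof.
rewrite graph_mapE !mulmxDr -fixp -(fix0 (subvP sS _ (subvsP (X x)))).
by rewrite !mulmxA Pm0 Pmp !mul0mx !add0r fixm ?subvsP.
Qed.

(** [Pp] undoes the graph map, which is therefore injective, and [Pp] kills [V0], so a graph vector
    lying in [V0] comes from 0. *)
Lemma dim_graph : \dim (V0 + graph_space X U) = (\dim V0 + \dim Vp)%N.
Proof.
rewrite dimv_disjoint_sum; last first.
  apply/eqP; rewrite -subv0; apply/subvP => w; rewrite memv_cap memv0.
  case/andP => /(subvP sV0)/fix0 w0 /memv_imgP [x _ wx].
  have x0 : x = 0.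
    by apply: val_inj; rewrite /= -Pp_graph -wx -w0 mulmxA Pp0 mul0mx.
  by rewrite wx x0 linear0.
congr (_ + _)%N; rewrite /graph_space limg_dim_eq.
  by rewrite dimvf.
rewrite capfv; apply/eqP/lker0P => x y exy; apply: val_inj => /=.
by rewrite -!Pp_graph exy.
Qed.

(** If u and v have graph parameters x and y, the form takes the value <x, y> - <Ux, Uy>: the
    components in the range of [P0] drop out. Polarization turns the equality of norms in [isoU]
    into the equality of these inner products. *)
Lemma isotropic_graph : isotropic (V0 + graph_space X U).
Proof.
have graphP w : w \in (V0 + graph_space X U)%VS ->
    exists2 x, Pp *m w = incl Vp x & Pm *m w = incl (mxrange Pm) (U x).
  case/memv_addP => v0 /(subvP sV0)/fix0 v0E [_ /memv_imgP [x _ ->]] ->.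
  exists x; rewrite inclE mulmxDr -v0E mulmxA ?Pp0 ?Pm0 mul0mx add0r.
    exact: Pp_graph.
  exact: Pm_graph.
move=> u v /graphP [x ux ux'] /graphP [y vy vy'].
have [[hp pp] [hm mm]] := (hPp, hPm).
rewrite mulmxBl linearBl /= -pp -mm -!mulmxA !(cdot_hermmx _ v) //.
rewrite ux ux' vy vy'; apply/eqP; rewrite subr_eq0; apply/eqP.
apply/esym; rewrite -!comp_lfunE; apply: polarization => z.
by rewrite comp_lfunE !inclE; apply: cnorm_eq.
Qed.
End Graph.

(* V0 is the zero part of W and V1 its complement in W.  Isotropy makes Pp
   injective on V1, so V1 is the graph over Vp = Pp V1 of the inverse g of Pp
   on V1, whose zero and negative components are X and U. *)
Lemma isotropic_decomp W : isotropic W ->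
  exists (V0 Vp : {vspace 'cV[C]_N})
    (X : 'Hom(subvs_of Vp, subvs_of (ocompl V0 :&: mxrange P0)%VS))
    (U : 'Hom(subvs_of Vp, subvs_of (mxrange Pm))),
  [/\ (V0 <= mxrange P0)%VS, (Vp <= mxrange Pp)%VS,
     forall x : subvs_of Vp, cnorm (vsval (U x)) = cnorm (vsval x)
   & W = (V0 + graph_space X U)%VS].
Proof.
move=> isoW; have [[hp pp] [h0 p0] [hm mm]] := And3 hPp hP0 hPm.
pose V0 := (W :&: mxrange P0)%VS; pose V1 := (W :&: ocompl V0)%VS.
pose S := (ocompl V0 :&: mxrange P0)%VS.
have sP u v : u \in W -> v \in W ->
    cdot (Pp *m u) (Pp *m v) = cdot (Pm *m u) (Pm *m v).
  move=> uW vW; rewrite -!(cdot_hermmx _ v) // !mulmxA pp mm.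
  by apply/eqP; rewrite -subr_eq0 -linearBl /= -mulmxBl; apply/eqP/isoW.
have sum1 v : Pp *m v + P0 *m v + Pm *m v = v by rewrite -!mulmxDl P1 mul1mx.
pose f : 'Hom(subvs_of V1, 'cV[C]_N) := (colop Pp \o incl V1)%VF.
have fE x : f x = Pp *m vsval x by rewrite comp_lfunE inclE colopE.
(* If [Pp] kills x in [V1], isotropy forces |Pm x| = |Pp x| = 0, so x = P0 x lies in [V0]; but x is
   also orthogonal to [V0]. *)
have f_inj : lker f == 0%VS.
  rewrite -subv0; apply/subvP => x; rewrite memv_ker memv0 fE => /eqP Ppx.
  have /[!memv_cap] /andP[xW xV0] := subvsP x.
  have Pmx : Pm *m vsval x = 0.
    by apply: cdot_eq0; rewrite -sP // Ppx linear0l.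
  have P0x : vsval x \in V0.
    rewrite memv_cap xW memv_mxrange //.
    by rewrite -{2}(sum1 (vsval x)) Ppx Pmx add0r addr0 eqxx.
  apply/eqP/val_inj/eqP; rewrite /= -memv0 -(capv_ocompl V0) memv_cap.
  by rewrite P0x.
pose Vp := limg f.
pose g : 'Hom(subvs_of Vp, subvs_of V1) := (f^-1 \o incl Vp)%VF.
have Ppg x : Pp *m vsval (g x) = vsval x.
  by rewrite -fE [g x]comp_lfunE inclE limg_lfunVK ?subvsP.
pose h := (incl V1 \o g)%VF.
have hE x : h x = vsval (g x) by rewrite comp_lfunE inclE.
pose X : 'Hom(subvs_of Vp, subvs_of S) := (linfun (vsproj S) \o (colop P0 \o h))%VF.
pose U : 'Hom(subvs_of Vp, subvs_of (mxrange Pm)) :=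
  (linfun (vsproj (mxrange Pm)) \o (colop Pm \o h))%VF.
have XE x : vsval (X x) = P0 *m vsval (g x).
  rewrite comp_lfunE lfunE /= comp_lfunE colopE hE vsprojK //.
  rewrite memv_cap memv_mxrange // mulmxA p0 eqxx andbT.
  (* [P0] preserves orthogonality to [V0]: it is Hermitian and fixes every v in [V0], so <P0 (g x),
     v> = <g x, v> = 0. *)
  apply/mem_orthovP => v vV0; have /[!memv_cap] /andP[_] := vV0.
  rewrite memv_mxrange // => /eqP P0v; rewrite /= cdot_hermmx // P0v.
  by have /[!memv_cap] /andP[_ /mem_orthovP gV0] := subvsP (g x); exact: gV0.
have UE x : vsval (U x) = Pm *m vsval (g x).
  rewrite comp_lfunE lfunE /= comp_lfunE colopE hE vsprojK //.
  by rewrite memv_mxrange // mulmxA mm.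
exists V0, Vp, X, U; split.
- exact: capvSr.
- apply/subvP => _ /memv_imgP [x _ ->].
  by rewrite fE memv_mxrange // mulmxA pp.
- move=> x; have /[!memv_cap] /andP[gW _] := subvsP (g x).
  by rewrite /cnorm UE -sP // Ppg.
have graphE : graph_space X U = limg h.
  congr (limg _); apply/lfunP => x; rewrite graph_mapE hE -[RHS]sum1.
  by rewrite Ppg XE UE.
(* The parameter that reaches v in [V1] is Pp v, since [g] inverts [f]. *)
have -> : graph_space X U = V1.
  rewrite graphE; apply/vspaceP => v; apply/memv_imgP/idP => [[x _ ->]|vV1].
    by rewrite hE subvsP.
  pose y := vsproj V1 v; have yv : vsval y = v by exact: vsprojK.
  exists (vsproj Vp (f y)); rewrite ?memvf // -yv hE; congr vsval.
  apply: (lker0P f_inj); rewrite [RHS]fE Ppg vsprojK //.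
  by rewrite memv_img ?memvf.
(* Subtracting from v in [W] its projection onto [V0] leaves a vector of [W] orthogonal to [V0],
   because [V0] is contained in [W]. *)
apply/eqP; rewrite eqEsubv; apply/andP; split; last by rewrite subv_add !capvSl.
apply/subvP => v vW; rewrite -(subrK (daddv_pi V0 (ocompl V0) v) v) addrC.
have piV0 := memv_pi V0 (ocompl V0) v.
apply: memv_add => //; rewrite memv_cap daddv_pi_ocompl andbT.
by rewrite rpredB // (subvP (capvSl _ _) _ piV0).
Qed.

End Signature.

(** * Compressions by a projection as sesquilinear forms on its range *)

Lemma compression_eq0P P B : is_orthoproj P ->
  P *m B *m P = 0 <-> {in mxrange P &, forall u v, cdot (B *m u) v = 0}.
Proof.
case=> hP PP; split=> [PBP0 u v | B0].
  rewrite !memv_mxrange // => /eqP <- /eqP <-.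
  by rewrite -cdot_hermmx // !mulmxA PBP0 mul0mx linear0l.
apply: mx_eqP => u; apply: cdot_eq => v; rewrite -!mulmxA mul0mx linear0l.
by rewrite cdot_hermmx // B0 // memv_mxrange // mulmxA PP.
Qed.

Lemma compression_scalarP P A (c : C) : P *m P = P ->
  P *m A *m P = c *: P <-> P *m (A - c%:M) *m P = 0.
Proof.
move=> PP; rewrite mulmxBr mulmxBl mul_mx_scalar -scalemxAl PP; split.
  by move=> ->; rewrite subrr.
by move/eqP; rewrite subr_eq0 => /eqP.
Qed.

(** For the projection P onto [W], <PBPu, v> = <B(Pu), Pv>, so PBP = 0 exactly when the form of B
    vanishes on [W]. With B = A - cI, PBP equals PAP - cP. *)
Lemma compression_scalar W A (c : C) :
  {in W &, forall u v, cdot ((A - c%:M) *m u) v = 0} <->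
  orthoproj W *m A *m orthoproj W = c *: orthoproj W.
Proof.
have hW := is_orthoproj_orthoproj W; have [_ WW] := hW.
rewrite compression_scalarP // compression_eq0P //.
by rewrite mxrange_orthoproj.
Qed.

(** Reality of the eigenvalue [lambda] is what makes A - lambda I Hermitian in the theorem. *)
Lemma leigenvalue_real A (c : C) : A \is hermsymmx ->
  passmx.leigenvalue (colop A) c -> c \is Num.real.
Proof.
rewrite /passmx.leigenvalue -vpick0 => hA; set v := vpick _.
have : v \in passmx.leigenspace (colop A) c by exact: memv_pick.
clearbody v; rewrite memv_ker !lfunE /= opp_lfunE scale_lfunE id_lfunE.
rewrite colopE subr_eq0.
move=> /eqP Av v0; have vv0 : cdot v v != 0.
  by apply: contraNneq v0 => /cdot_eq0 ->.
have := cdot_hermmx v v hA; rewrite Av linearZl_LR linearZr_LR /=.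
by move=> /(mulIf vv0) cc; rewrite CrealE -cc.
Qed.

End InnerProduct.

(** * Functional calculus and spectral projections of a Hermitian matrix *)

Section FunctionalCalculus.
Variables (C : numClosedFieldType) (N : nat) (B : 'M[C]_N).
Implicit Types (g h : C -> C) (v : 'cV[C]_N).

Local Notation S := (spectralmx B).
Local Notation d := (spectral_diag B).

(** Functions on C, rather than on the reals as in [mxfun], put f(B), B itself and the spectral
    projections into one calculus, where matrix identities reduce to scalar ones. *)
Definition mxcalc g : 'M[C]_N := invmx S *m diag_mx (map_mx g d) *m S.

Lemma mxcalcM g h : mxcalc g *m mxcalc h = mxcalc (fun z => g z * h z).
Proof.
rewrite /mxcalc !mulmxA mulmxK ?spectral_unit // -[X in X *m S]mulmxA mulmx_diag.
by congr (_ *m diag_mx _ *m _); apply/rowP => j; rewrite !mxE.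
Qed.

Lemma mxcalcD g h : mxcalc g + mxcalc h = mxcalc (fun z => g z + h z).
Proof.
rewrite /mxcalc -mulmxDl -mulmxDr -linearD.
by congr (_ *m diag_mx _ *m _); apply/rowP => j; rewrite !mxE.
Qed.

Lemma mxcalcB g h : mxcalc g - mxcalc h = mxcalc (fun z => g z - h z).
Proof.
rewrite /mxcalc -mulmxBl -mulmxBr -linearB.
by congr (_ *m diag_mx _ *m _); apply/rowP => j; rewrite !mxE.
Qed.

Lemma mxcalc0 : mxcalc (fun=> 0) = 0.
Proof.
rewrite /mxcalc; set r := map_mx _ _.
have -> : r = 0 by apply/rowP => j; rewrite !mxE.
by rewrite linear0 mulmx0 mul0mx.
Qed.

Lemma mxcalc1 : mxcalc (fun=> 1) = 1%:M.
Proof.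
rewrite /mxcalc; set r := map_mx _ _.
have -> : r = const_mx 1 by apply/rowP => j; rewrite !mxE.
by rewrite diag_const_mx mulmx1 mulVmx ?spectral_unit.
Qed.

Lemma mxcalc_conj g : (mxcalc g)^t* = mxcalc (fun z => (g z)^*).
Proof.
rewrite /mxcalc (invmx_unitary (spectral_unitarymx B)) !trmx_mul !map_mxM trmxCK.
rewrite tr_diag_mx map_diag_mx mulmxA.
by congr (_ *m diag_mx _ *m _); apply/rowP => j; rewrite !mxE.
Qed.

Hypothesis hB : B \is hermsymmx.

Let d_real j : d 0 j \is Num.real.
Proof. by have /mxOverP := hermitian_spectral_diag_real hB. Qed.

Lemma eq_mxcalc g h : {in Num.real, g =1 h} -> mxcalc g = mxcalc h.
Proof.
move=> gh; congr (_ *m diag_mx _ *m _); apply/rowP => j.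
by rewrite !mxE gh.
Qed.

Lemma mxcalc_id : mxcalc id = B.
Proof.
have /orthomx_spectralP := hermitian_normalmx hB.
by rewrite /mxcalc map_mx_id.
Qed.

Lemma mxcalc_herm g : {in Num.real, forall z, g z \is Num.real} ->
  mxcalc g \is hermsymmx.
Proof.
move=> g_real; rewrite hermsymmxE mxcalc_conj; apply/eqP/eq_mxcalc => z zR.
by rewrite conj_Creal ?g_real.
Qed.

(** In the eigenbasis, with y = S v, the hypothesis reads (d_i - c) y_i = 0: at each index either
    d_i = c or y_i = 0, and in both cases g(d_i) y_i = g(c) y_i. *)
Lemma mxcalc_eigen g c v : B *m v = c *: v -> mxcalc g *m v = g c *: v.
Proof.
rewrite -{1}mxcalc_id /mxcalc -!mulmxA => Bv.
have {}Bv : diag_mx (map_mx id d) *m (S *m v) = c *: (S *m v).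
  by rewrite -[LHS](mulKVmx (spectral_unit B)) Bv scalemxAr.
rewrite -[v in RHS](mulKmx (spectral_unit B)) scalemxAr; congr (_ *m _).
apply/colP => i; move/colP/(_ i): Bv; rewrite !mul_diag_mx !mxE.
set y := \sum_j _ => /eqP; rewrite -subr_eq0 -mulrBl mulf_eq0 subr_eq0.
by case/orP => /eqP -> //; rewrite !mulr0.
Qed.

Variable p : pred C.
Let ind z : C := (p z)%:R.

Lemma is_orthoproj_ind : is_orthoproj (mxcalc ind).
Proof.
split; first by apply: mxcalc_herm => z _; exact: realn.
by rewrite mxcalcM; apply: eq_mxcalc => z _; rewrite /ind -natrM mulnb andbb.
Qed.

(** The columns of [invmx S] are eigenvectors of [B], and the indicator keeps those whose eigenvalue
    satisfies [p]. Conversely, by [mxcalc_eigen], the indicator matrix fixes every eigenvector with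
    such an eigenvalue. *)
Lemma mxrange_ind : mxrange (mxcalc ind) = eigspan B p.
Proof.
have [_ PP] := is_orthoproj_ind.
have leigP v c : (v \in passmx.leigenspace (colop B) c) = (B *m v == c *: v).
  by rewrite memv_ker !lfunE /= opp_lfunE scale_lfunE id_lfunE colopE subr_eq0.
apply/eqP; rewrite eqEsubv; apply/andP; split; apply/subvP => v; last first.
  case/memv_sumP => w wE ->; apply: rpred_sum => j pj.
  have Bw : B *m w j = d 0 j *: w j by apply/eqP; rewrite -leigP; exact: wE.
  by rewrite memv_mxrange // (mxcalc_eigen ind Bw) /ind pj scale1r.
rewrite memv_mxrange // => /eqP <-.
have -> : mxcalc ind *m v =
    \sum_(j | p (d 0 j)) ((S *m v) j 0 *: col j (invmx S)).
  rewrite /mxcalc -!mulmxA; apply/colP => i; rewrite mxE summxE [RHS]big_mkcond.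
  apply: eq_bigr => j _; rewrite mul_diag_mx !mxE /ind.
  by case: (p _); rewrite ?mul0r ?mulr0 // mul1r mulrC.
apply: memv_sumr => j _; rewrite rpredZ // leigP; apply/eqP.
rewrite -{1}mxcalc_id /mxcalc map_mx_id // colE -!mulmxA mulKVmx ?spectral_unit //.
rewrite scalemxAr; congr (_ *m _); apply/colP => i.
by rewrite mul_diag_mx !mxE andbT; case: eqVneq => [->|]; rewrite ?mulr0.
Qed.

Lemma orthoproj_eigspan : orthoproj (eigspan B p) = mxcalc ind.
Proof. by rewrite -mxrange_ind orthoproj_mxrange //; exact: is_orthoproj_ind. Qed.

End FunctionalCalculus.

(** * Transport of the form of B to the form of P_+ - P_- by f(B) *)

Section CompressionForm.
Variables (R : realType) (N : nat) (B : 'M[R[i]]_N).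
Hypothesis hB : B \is hermsymmx.

Local Notation F := (mxfun (@inv_sqrt_abs R) B).
Local Notation Pp := (proj_pos B).
Local Notation P0 := (proj_zero B).
Local Notation Pm := (proj_neg B).

Lemma mxfunE (f : R -> R) :
  mxfun f B = mxcalc B (fun z => real_complex R (f (complex.Re z))).
Proof. by []. Qed.

(** The value f(0) = 1 keeps f nonzero on the kernel of B as well, so that f(B) is invertible. *)
Lemma inv_sqrt_abs_neq0 (x : R) : inv_sqrt_abs x != 0.
Proof.
rewrite /inv_sqrt_abs; case: (eqVneq x 0) => [_|x0]; first exact: oner_neq0.
by rewrite gt_eqF // powR_gt0 // normr_gt0.
Qed.

(** Both sides are the sign of x; this is the scalar identity behind f(B) B f(B) = P_+ - P_-. *)
Lemma inv_sqrt_abs_conj (x : R) :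
  inv_sqrt_abs x * x * inv_sqrt_abs x = (0 < x)%R%:R - (x < 0)%R%:R.
Proof.
rewrite /inv_sqrt_abs; case: (ltrgt0P x) => [x0|x0|->].
- rewrite powRN powR12_sqrt ?ltW // subr0 mulrAC -invfM -expr2.
  by rewrite sqr_sqrtr ?ltW // mulVf ?gt_eqF.
- rewrite powRN powR12_sqrt ?oppr_ge0 ?ltW // sub0r mulrAC -invfM -expr2.
  by rewrite sqr_sqrtr ?oppr_ge0 ?ltW // invrN mulNr mulVf ?lt_eqF.
- by rewrite mulr0 mul0r subrr.
Qed.

Lemma mxfun_herm (f : R -> R) : mxfun f B \is hermsymmx.
Proof.
by rewrite mxfunE; apply: mxcalc_herm => // z _; apply/complex_realP; eexists.
Qed.

Lemma mxfun_inv_sqrt_abs_conj : F *m B *m F = Pp - Pm.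
Proof.
rewrite /proj_pos /proj_neg !orthoproj_eigspan // mxcalcB mxfunE.
rewrite -[X in _ *m X *m _](mxcalc_id hB) !mxcalcM.
apply: eq_mxcalc => // _ /complex_realP [x ->].
by rewrite -!rmorphM /= inv_sqrt_abs_conj rmorphB !rmorph_nat (ltcR 0 x) (ltcR x 0).
Qed.

Lemma lker_inv_sqrt_abs : lker (colop F) == 0%VS.
Proof.
pose G := mxfun (fun x : R => (inv_sqrt_abs x)^-1) B.
have GF : G *m F = 1%:M.
  rewrite /G !mxfunE mxcalcM -(mxcalc1 B); apply: eq_mxcalc => // z _.
  by rewrite -rmorphM mulVf ?rmorph1 // inv_sqrt_abs_neq0.
apply/lker0P => u v; rewrite !colopE => /(congr1 (mulmx G)).
by rewrite [LHS]mulmxA [RHS]mulmxA GF !mul1mx.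
Qed.

Lemma proj_sum : Pp + P0 + Pm = 1%:M.
Proof.
rewrite /proj_pos /proj_zero /proj_neg !orthoproj_eigspan // !mxcalcD -(mxcalc1 B).
apply: eq_mxcalc => // x xR /=; rewrite -!natrD.
by case: (real_ltgt0P xR).
Qed.

Lemma proj_mul0 (p q : pred R[i]) : (forall z, ~~ (p z && q z)) ->
  orthoproj (eigspan B p) *m orthoproj (eigspan B q) = 0.
Proof.
move=> pq; rewrite !orthoproj_eigspan // mxcalcM -(mxcalc0 B).
by apply: eq_mxcalc => // z _; rewrite -natrM mulnb (negPf (pq z)).
Qed.

(** Since F = f(B) is Hermitian, <B F u, F v> = <F B F u, v> = <(P_+ - P_-) u, v>. *)
Lemma isotropic_image V :
  isotropic Pp Pm V <->
  {in (colop F @: V)%VS &, forall u v, cdot (B *m u) v = 0}.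
Proof.
split=> [isoV _ _ /memv_imgP [u uV ->] /memv_imgP [v vV ->] | B0 u v uV vV].
  by rewrite !colopE -cdot_hermmx ?mxfun_herm // (mulmxA F) (mulmxA (F *m B))
    mxfun_inv_sqrt_abs_conj isoV.
rewrite -mxfun_inv_sqrt_abs_conj -(mulmxA (F *m B)) -(mulmxA F).
rewrite cdot_hermmx ?mxfun_herm //.
by have := B0 _ _ (memv_img (colop F) uV) (memv_img (colop F) vV); rewrite !colopE.
Qed.

Let hPp : is_orthoproj Pp. Proof. exact: is_orthoproj_orthoproj. Qed.
Let hP0 : is_orthoproj P0. Proof. exact: is_orthoproj_orthoproj. Qed.
Let hPm : is_orthoproj Pm. Proof. exact: is_orthoproj_orthoproj. Qed.

Let Pp0 : Pp *m P0 = 0.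
Proof. by apply: proj_mul0 => z; apply/negP => /andP[/gt_eqF ->]. Qed.

Let Ppm : Pp *m Pm = 0.
Proof. by apply: proj_mul0 => z; apply/negP => /andP[/lt_gtF ->]. Qed.

Let Pm0 : Pm *m P0 = 0.
Proof. by apply: proj_mul0 => z; apply/negP => /andP[/lt_eqF ->]. Qed.

Lemma dim_colop_inv_sqrt_abs V : \dim (colop F @: V) = \dim V.
Proof. by rewrite limg_dim_eq // (eqP lker_inv_sqrt_abs) capv0. Qed.

Lemma form_graph_image V0 Vp
    (X : 'Hom(subvs_of Vp, subvs_of (ocompl V0 :&: mxrange P0)%VS))
    (U : 'Hom(subvs_of Vp, subvs_of (mxrange Pm))) :
    (V0 <= mxrange P0)%VS -> (Vp <= mxrange Pp)%VS ->
    (forall x : subvs_of Vp, cnorm (vsval (U x)) = cnorm (vsval x)) ->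
  let W := (colop F @: (V0 + graph_space X U))%VS in
  \dim W = (\dim V0 + \dim Vp)%N /\
  {in W &, forall u v, cdot (B *m u) v = 0}.
Proof.
move=> sV0 sVp isoU W; rewrite {}/W.
have sS := capvSr (ocompl V0) (mxrange P0); split.
  rewrite dim_colop_inv_sqrt_abs.
  exact: (dim_graph hPp hP0 hPm Pp0 Ppm X U sV0 sVp sS).
have isoV := isotropic_graph hPp hP0 hPm Pp0 Ppm Pm0 sV0 sVp sS isoU.
exact: (iffLR (isotropic_image _) (isoV X)).
Qed.

(** Invertibility of f(B) allows [W] to be pulled back to a subspace that is isotropic for P_+ -
    P_-; the decomposition of that subspace is then pushed forward. *)
Lemma form_graph_preimage (W : {vspace 'cV[R[i]]_N}) :
  {in W &, forall u v, cdot (B *m u) v = 0} ->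
  exists (V0 Vp : {vspace 'cV[R[i]]_N})
    (X : 'Hom(subvs_of Vp, subvs_of (ocompl V0 :&: mxrange P0)%VS))
    (U : 'Hom(subvs_of Vp, subvs_of (mxrange Pm))),
  [/\ (V0 <= mxrange P0)%VS, (Vp <= mxrange Pp)%VS,
     forall x : subvs_of Vp, cnorm (vsval (U x)) = cnorm (vsval x)
   & W = (colop F @: (V0 + graph_space X U))%VS].
Proof.
move=> BW; pose V := ((colop F)^-1 @: W)%VS.
have FV : W = (colop F @: V)%VS.
  by rewrite -limg_comp lker0_compfV ?lker_inv_sqrt_abs // lim1g.
have isoV : isotropic Pp Pm V by apply: (iffRL (isotropic_image V)); rewrite -FV.
have := isotropic_decomp hPp hP0 hPm proj_sum isoV.
case=> V0 [Vp [X [U [sV0 sVp isoU defV]]]].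
exists V0, Vp, X, U; split; [exact: sV0 | exact: sVp | exact: isoU |].
by rewrite -defV.
Qed.

End CompressionForm.

(** * Both directions of the parametrization, read off from the form of A - lambda I *)

Theorem mainTheorem3 (R : realType) (N : nat) (A : 'M[R[i]]_N) (k : nat)
    (lambda : R[i]) :
  A \is hermsymmx ->
  (1 <= k)%N ->
  rank_numrange k A lambda ->
  passmx.leigenvalue (colop A) lambda ->
  (forall W : {vspace 'cV[R[i]]_N}, constructed A lambda k W ->
     \dim W = k /\
     orthoproj W *m A *m orthoproj W = lambda *: orthoproj W) /\
  (forall P : 'M[R[i]]_N,
     is_orthoproj P -> \rank P = k -> P *m A *m P = lambda *: P ->
     exists2 W : {vspace 'cV[R[i]]_N},
       constructed A lambda k W & P = orthoproj W).
Proof.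
move=> hA _ _ /(leigenvalue_real hA) lR.
have hB : A - lambda%:M \is hermsymmx.
  rewrite hermsymmxE linearB /= tr_scalar_mx map_mxB map_scalar_mx.
  by move: hA; rewrite hermsymmxE => /eqP <-; rewrite /= conj_Creal.
split=> [_ [B k1 k2 V0 Vp X U k12 _ _ sV0 dV0 sVp dVp isoU] | P hP rP PAP].
  have [dW BW] := form_graph_image hB X sV0 sVp isoU.
  split; last exact/compression_scalar.
  by apply: etrans dW _; rewrite dV0 dVp.
have defP := orthoproj_mxrange hP; rewrite -defP in PAP.
have /compression_scalar/(form_graph_preimage hB) := PAP.
case=> V0 [Vp [X [U [sV0 sVp isoU defW]]]].
exists (mxrange P); last by rewrite defP.
have [dW _] := form_graph_image hB X sV0 sVp isoU.
have sub_dim := dim_isometry isoU.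
(* With k1 and k2 taken as the dimensions of [V0] and [Vp], the dimension formula of the direct
   half, applied to the range of P, gives k1 + k2 = rank P. *)
have k12 : (\dim V0 + \dim Vp)%N = k by rewrite -dW -defW dim_mxrange.
have le1 := dimvS sV0.
have le2 : (\dim Vp <= minn (\dim (mxrange (proj_neg (A - lambda%:M))))
                            (\dim (mxrange (proj_pos (A - lambda%:M)))))%N.
  rewrite leq_min; apply/andP; exact: (conj sub_dim (dimvS sVp)).
rewrite defW.
exact: (Constructed X k12 le1 le2 sV0 (erefl _) sVp (erefl _) isoU).
Qed.
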